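(* Let $G$ be a finitely generated group. Either $G_{bound}$ has infinite index in $G$, or $G$ is finite and $G=G_{bound}$.
   Context: For a finitely generated group $G$, a finite generating set $S$ of $G$ and $g\in G$, the word-length $l_S(g)$ is the minimal integer $n\ge 0$ such that $g$ is a product of $n$ elements of $S\cup S^{-1}$. $G_{bound}$ denotes the set of all $g\in G$ for which there exists a constant $M>0$ such that $l_S(g)<M$ for every finite generating set $S$ of $G$; it is a subgroup of $G$. *)

(* Defs.v *)
From mathcomp Require Import all_boot.
From mathcomp Require Import boolp classical_sets functions cardinality.
Set Implicit Arguments.
Unset Strict Implicit.
Unset Printing Implicit Defensive.

Local Open Scope classical_set_scope.
Local Open Scope group_scope.

Definition is_subgroup (G : groupType) (H : set G) : Prop := group_closed (mem H).

Definition generated (G : groupType) (S : set G) : set G :=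
  smallest (@is_subgroup G) S.

Definition generates (G : groupType) (S : set G) : Prop :=
  generated S = [set: G].

Definition finitely_generated (G : groupType) : Prop :=
  exists2 S : set G, finite_set S & generates S.

Definition sym_gens (G : groupType) (S : set G) : set G :=
  S `|` [set x^-1 | x in S].

Definition product_of_length (G : groupType) (S : set G) (n : nat) (g : G) : Prop :=
  exists w : n.-tuple G,
    (forall x, x \in w -> sym_gens S x) /\ \prod_(x <- w) x = g.

Lemma product_of_length_exists (G : groupType) (S : set G) (g : G) :
  generates S -> exists n, `[< product_of_length S n g >].
Proof.
move=> genS.
pose K : set G := [set x | exists n, product_of_length S n x].
have KV n x : product_of_length S n x -> product_of_length S n x^-1.
  move=> [w [wS <-]]; exists [tuple of rev (map (fun y : G => y^-1) w)]; split.
    move=> x'; rewrite mem_rev => /mapP[y yw ->].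
    case: (wS y yw) => [Sy|[z Sz <-]]; first by right; exists y.
    by left; rewrite invgK.
  have -> : \prod_(i <- w) i = ((\prod_(i <- rev (rev w)) i)^-1)^-1.
    by rewrite revK invgK.
  by rewrite -prodgV invgK /= -map_rev big_map.
have sgK : is_subgroup K.
  split; first by rewrite inE; exists 0; exists [tuple]; split=> //; rewrite big_nil.
  move=> x y /set_mem[n [u [uS <-]]] /set_mem[m /KV[v [vS vy]]].
  apply/mem_set; exists (n + m); exists [tuple of u ++ v]; split.
    by move=> z; rewrite mem_cat => /orP[/uS|/vS].
  by rewrite big_cat /= vy.
have SK : S `<=` K.
  move=> x Sx; exists 1%N; exists [tuple x]; split; last by rewrite big_seq1.
  by move=> y; rewrite inE => /eqP ->; left.
have : [set: G] g by [].
rewrite -genS => /(smallest_sub sgK SK)[n gn].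
by exists n; apply/asboolP.
Qed.

                                                  
Definition word_length (G : groupType) (S : set G) (genS : generates S) (g : G) : nat :=
  ex_minn (product_of_length_exists g genS).

Definition G_bound (G : groupType) : set G :=
  [set g | exists2 M : nat, 0 < M &
     forall (S : set G) (genS : generates S), finite_set S ->
       word_length genS g < M].

Definition left_cosets (G : groupType) (H : set G) : set (set G) :=
  range (fun x : G => [set x * h | h in H]).

Definition infinite_index (G : groupType) (H : set G) : Prop :=
  infinite_set (left_cosets H).

(* Main.v *)
Require Import Defs.
From mathcomp Require Import all_boot.
From mathcomp Require Import boolp classical_sets functions cardinality.
From mathcomp Require Import zify.

(** Write B for G_bound, and suppose that B has finite index in G; the point is
    that G is then finite.

    Conjugating a generating set by g changes the length of x into the length
    of a conjugate of x.  So if x is bounded by n, all conjugates of x lie in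
    one ball of radius n, which is finite: every element of B has finitely many
    conjugates ([G_bound_finite_class]), and B is normal.  By Schreier's lemma
    ([schreier]) B is finitely generated, so the centralizer of B, being the
    intersection of the centralizers of finitely many elements, has finite
    index.  Its intersection A with B is the centre of B: an abelian normal
    subgroup of finite index, which is again finitely generated.

    The core of the proof is that every bounded element a of A is torsion
    ([G_bound_torsion]).  The transfer-like product over G / A gives a crossed
    homomorphism u : G -> A with u(a) = a^d on A ([transfer_crossed_hom]), hence
    endomorphisms E(g) = u(g)^m g of G that induce the identity on G / A and
    raise the elements of A to the power p = 1 + dm ([dilation]).  If S generates
    G and L generates A, then for each r prime to p the elements E(s), for s in
    S, and b^r, for b in L, still generate G.  A word of length n in them that
    falls in A equals y^r v^p with y and v in A taken from a finite set that
    depends on n, S and L but neither on m nor on r ([dilated_ball]).  Take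
    r = dk and p = 1 + r^2.  If a is bounded, then a = y^r v^(1 + r^2) can be
    solved for every k, so some pair (y, v) serves three values of k.  The
    second differences of the exponents then show that v, y and a are torsion
    ([torsion_quadratic]).  The quadratic choice of p matters: were p linear in
    r, the difference p - c r could be a constant 1, and y = a^(-c), v = a would
    be a solution for all r.

    Hence A is abelian, finitely generated and torsion, so it is finite, and so
    is G.  Conversely a finite group has finitely many generating sets, so
    every element is bounded ([G_bound_finite]). *)

Local Open Scope classical_set_scope.

Section Groups.
Local Open Scope group_scope.
Variable G : groupType.
Implicit Types (H K S L A : set G) (x y g h : G).

(** * Subgroups and generation *)

Lemma is_subgroupP H : is_subgroup H <->
  [/\ H 1, forall x y, H x -> H y -> H (x * y) & forall x, H x -> H x^-1].
Proof.
split=> [sgH|[H1 HM HV]].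
  have [H1 _] := sgH; split; first exact/set_mem.
    by move=> x y /mem_set Hx /mem_set Hy; apply/set_mem/(group_closedM sgH).
  by move=> x /mem_set Hx; apply/set_mem/(group_closedV sgH).
split; first exact/mem_set.
by move=> x y /set_mem Hx /set_mem Hy; apply/mem_set/HM => //; apply: HV.
Qed.

Lemma is_subgroupX H x n : is_subgroup H -> H x -> H (x ^+ n).
Proof.
move=> /is_subgroupP[H1 HM _] Hx.
by elim: n => [|n IH] //; rewrite expgS; apply: HM.
Qed.

Lemma generated_is_subgroup S : is_subgroup (generated S).
Proof.
apply/is_subgroupP; split.
- by move=> K /= [/is_subgroupP[K1 _ _] _].
- move=> x y gx gy K KS; have [/is_subgroupP[_ KM _] _] := KS.
  by apply: KM; [apply: gx|apply: gy].
- move=> x gx K KS; have [/is_subgroupP[_ _ KV] _] := KS.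
  by apply: KV; exact: gx.
Qed.

Lemma subset_generated S : S `<=` generated S.
Proof. exact: sub_gen_smallest. Qed.

Lemma generated_min S H : is_subgroup H -> S `<=` H -> generated S `<=` H.
Proof. exact: smallest_sub. Qed.

Lemma generates_ind S H : generates S -> is_subgroup H -> S `<=` H ->
  forall x, H x.
Proof.
move=> gS sgH SH x; apply: (generated_min _ _ sgH SH).
by rewrite (gS : generated S = _).
Qed.

Lemma cent_is_subgroup L : is_subgroup [set g | forall t, L t -> commute t g].
Proof.
apply/is_subgroupP; split=> [t _|x y cx cy t Lt|x cx t Lt].
- exact: commute1.
- by apply: commuteM; [apply: cx|apply: cy].
- by apply: commuteV; apply: cx.
Qed.

Lemma setI_is_subgroup H K :
  is_subgroup H -> is_subgroup K -> is_subgroup (H `&` K).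
Proof.
move=> /is_subgroupP[H1 HM HV] /is_subgroupP[K1 KM KV].
by apply/is_subgroupP; split=> // [x y [? ?] [? ?]|x [? ?]]; split; auto.
Qed.

(** * Balls for the word length *)

Lemma product_of_length0 S x : product_of_length S 0 x <-> x = 1.
Proof.
split=> [[w [_ <-]]|->]; first by rewrite tuple0 big_nil.
by exists [tuple]; split=> //; rewrite big_nil.
Qed.

Lemma product_of_lengthS S n x : product_of_length S n.+1 x <->
  exists s y, [/\ sym_gens S s, product_of_length S n y & x = s * y].
Proof.
split=> [[w [Sw <-]]|[s [y [Ss [w [Sw <-]] ->]]]].
  case/tupleP: w Sw => s w Sw; exists s, (\prod_(z <- w) z); split.
  - by apply: Sw; rewrite inE eqxx.
  - by exists w; split=> // z zw; apply: Sw; rewrite inE zw orbT.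
  - by rewrite /= big_cons.
exists [tuple of s :: w]; split; last by rewrite big_cons.
by move=> z; rewrite inE => /predU1P[->//|/Sw].
Qed.

(** A ball is not made of words of length exactly n, since a word cannot in
    general be padded: 1 need not be a product of one generator. *)
Definition ball S n : set G :=
  [set x | exists2 m, m <= n & product_of_length S m x].

Lemma ballW S m n : m <= n -> ball S m `<=` ball S n.
Proof. by move=> mn x [p pm Sx]; exists p => //; apply: leq_trans mn. Qed.

Lemma ball1 S n : ball S n 1.
Proof. by exists 0 => //; apply/product_of_length0. Qed.

Lemma sym_gensV S x : sym_gens S x -> sym_gens S x^-1.
Proof. by case=> [Sx|[y Sy <-]]; [right; exists x|left; rewrite invgK]. Qed.

Lemma ball_sym S x : sym_gens S x -> ball S 1 x.
Proof.
move=> Sx; exists 1%N => //; apply/product_of_lengthS; exists x, 1.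
by split; rewrite ?mulg1 //; apply/product_of_length0.
Qed.

Lemma ballM S m n x y : ball S m x -> ball S n y -> ball S (m + n) (x * y).
Proof.
move=> [p pm Sx] [q qn Sy]; exists (p + q); first exact: leq_add.
elim: p x Sx {pm} => [|p IH] x; first by move=> /product_of_length0->; rewrite mul1g.
move=> /product_of_lengthS[s [z [Ss Sz ->]]].
rewrite addSn -mulgA; apply/product_of_lengthS; exists s, (z * y).
by split=> //; apply: IH.
Qed.

Lemma ballV S n x : ball S n x -> ball S n x^-1.
Proof.
move=> [m mn Sx]; apply: (ballW _ _ _ mn).
elim: m x Sx {mn} => [|m IH] x.
  by move=> /product_of_length0->; rewrite invg1; apply: ball1.
move=> /product_of_lengthS[s [y [Ss Sy ->]]].
by rewrite invgM -addn1; apply: ballM; [apply: IH|apply/ball_sym/sym_gensV].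
Qed.

Lemma ball_finite S n : finite_set S -> finite_set (ball S n).
Proof.
move=> finS.
have finP m : finite_set [set x | product_of_length S m x].
  elim: m => [|m IH].
    by apply: (sub_finite_set _ (finite_set1 1)) => x /product_of_length0.
  have finSy : finite_set (sym_gens S).
    by rewrite finite_setU; split=> //; apply: finite_image.
  apply: (sub_finite_set _ (finite_image2 (fun s y => s * y) finSy IH)) => x /=.
  by move=> /product_of_lengthS[s [y [Ss Sy ->]]]; exists s => //; exists y.
have -> : ball S n = \bigcup_(m in `I_n.+1) [set x | product_of_length S m x].
  by apply/seteqP; split=> x [m mn Sx]; exists m.
exact: bigcup_finite (finite_II _) _.
Qed.

Lemma word_length_ball S (gS : generates S) n x :
  (word_length gS x <= n)%N <-> ball S n x.
Proof.
rewrite /word_length; case: ex_minnP => m /asboolP Sm minm.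
split=> [mn|[p pn /asboolP/minm mp]]; first by exists m.
exact: leq_trans pn.
Qed.

(** * Bounded elements *)

Lemma G_boundP x : @G_bound G x <->
  exists n, forall S, generates S -> finite_set S -> ball S n x.
Proof.
split=> [[M _ bx]|[n bx]].
  exists M => S gS finS; apply/(word_length_ball S gS)/ltnW; exact: bx.
by exists n.+1 => // S gS finS; rewrite ltnS; apply/word_length_ball; apply: bx.
Qed.

Lemma G_bound_is_subgroup : is_subgroup (@G_bound G).
Proof.
apply/is_subgroupP; split.
- by apply/G_boundP; exists 0 => S _ _; apply: ball1.
- move=> x y /G_boundP[m bx] /G_boundP[n yb]; apply/G_boundP; exists (m + n).
  by move=> S gS fS; apply: ballM; [apply: bx|apply: yb].
- move=> x /G_boundP[m bx]; apply/G_boundP; exists m => S gS fS.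
  by apply: ballV; apply: bx.
Qed.

Lemma ball_conjg S n x g : ball S n x -> ball [set s ^ g | s in S] n (x ^ g).
Proof.
move=> [m mn Sx]; exists m => //.
elim: m x Sx {mn} => [|m IH] x.
  by move=> /product_of_length0->; apply/product_of_length0; rewrite conj1g.
move=> /product_of_lengthS[s [y [Ss Sy ->]]].
apply/product_of_lengthS; exists (s ^ g), (y ^ g); split; last exact: conjMg.
  case: Ss => [Ss|[t St <-]]; first by left; exists s.
  by right; exists (t ^ g); [exists t|rewrite conjVg].
exact: IH.
Qed.

Lemma conjg_setK S g : [set s ^ g^-1 | s in [set s ^ g | s in S]] = S.
Proof.
apply/seteqP; split=> [x [_ [s Ss <-] <-]|x Sx]; first by rewrite conjgK.
by exists (x ^ g); [exists x|rewrite conjgK].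
Qed.

Lemma generates_conjg S g : generates S -> generates [set s ^ g | s in S].
Proof.
move=> gS; apply/seteqP; split=> // x _.
rewrite -[x](conjgKV g); move: (x ^ g^-1) => {}x.
apply: (generates_ind S [set x | generated [set s ^ g | s in S] (x ^ g)]) => //.
  have /is_subgroupP[K1 KM KV] := generated_is_subgroup [set s ^ g | s in S].
  apply/is_subgroupP; split=> /= [|y z Ky Kz|y Ky].
  - by rewrite conj1g.
  - by rewrite conjMg; apply: KM.
  - by rewrite conjVg; apply: KV.
by move=> s Ss /=; apply: subset_generated; exists s.
Qed.

(** The length of x ^ g in S is the length of x in the conjugate of S by the
    inverse of g, so one bound serves a whole conjugacy class. *)
Lemma bounded_conjg n x g :
  (forall S, generates S -> finite_set S -> ball S n x) ->
  forall S, generates S -> finite_set S -> ball S n (x ^ g).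
Proof.
move=> bx S gS fS; rewrite -(conjg_setK S g^-1) invgK; apply: ball_conjg.
by apply: bx; [apply: generates_conjg|apply: finite_image].
Qed.

Lemma G_bound_conjg x g : @G_bound G x -> @G_bound G (x ^ g).
Proof.
move=> /G_boundP[n bx]; apply/G_boundP; exists n => S gS fS.
exact: bounded_conjg.
Qed.

(** A single ball of a single finite generating set contains all conjugates. *)
Lemma G_bound_finite_class x : finitely_generated G -> @G_bound G x ->
  finite_set (range (conjg x)).
Proof.
move=> [S fS gS] /G_boundP[n bx].
apply: (sub_finite_set _ (ball_finite S n fS)) => _ [g _ <-].
exact: bounded_conjg.
Qed.

Lemma finite_powerset (X : choiceType) :
  finite_set [set: X] -> finite_set [set: set X].
Proof.
move=> /finite_seqP[s es].
pose f (t : (size s).-tuple bool) : set X := [set x | nth false t (index x s)].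
apply: (sub_finite_set _ (finite_image f (@finite_finset _ setT))) => P _.
exists (map_tuple (fun x : X => `[< P x >]) (in_tuple s)) => //.
apply/seteqP; rewrite /f; split=> x /=.
  have xs : x \in s by have : [set: X] x by []; rewrite es.
  by rewrite (nth_map x) ?index_mem // nth_index // => /asboolP.
have xs : x \in s by have : [set: X] x by []; rewrite es.
by move=> Px; rewrite (nth_map x) ?index_mem // nth_index //; apply/asboolP.
Qed.

(** There are finitely many generating sets, and any set of finitely many
    lengths is bounded. *)
Lemma G_bound_finite : finite_set [set: G] -> [set: G] = @G_bound G.
Proof.
move=> finG; apply/seteqP; split=> // x _; apply/G_boundP.
have /choice[l lP] S : exists n, generates S -> ball S n x.
  have [gS|ngS] := pselect (generates S); last by exists 0.
  by have [n /asboolP Sn] := product_of_length_exists x gS; exists n => _; exists n.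
have /finite_seqP[s es] := finite_image l (finite_powerset _ finG).
exists (\max_(n <- s) n)%N => S gS _; apply: (ballW _ _ _ _ _ (lP S gS)).
have ls : [set` s] (l S) by rewrite -es; exists S.
exact: (@leq_bigmax_seq _ _ xpredT (fun n => n) _ ls isT).
Qed.

(** * Subgroups of finite index *)

Definition lcoset H x := [set x * h | h in H].

Definition finite_index H := finite_set (left_cosets H).

Lemma lcoset_eq H x y : is_subgroup H -> lcoset H x = lcoset H y <-> H (x^-1 * y).
Proof.
move=> /is_subgroupP[H1 HM HV]; split=> [e|Hxy].
  have : lcoset H y y by exists 1; rewrite ?mulg1.
  by rewrite -e => -[h Hh <-]; rewrite mulKg.
apply/seteqP; split=> [_ [h Hh <-]|_ [h Hh <-]].
  exists ((x^-1 * y)^-1 * h); first by apply: HM => //; apply: HV.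
  by rewrite invgM invgK !mulgA mulgV mul1g.
exists (x^-1 * y * h); first exact: HM.
by rewrite !mulgA mulgV mul1g.
Qed.

(** The usual way to bound an index: an invariant with finitely many values that
    separates the cosets of H. *)
Lemma finite_index_separated (X : Type) (f : G -> X) H : is_subgroup H ->
  finite_set (range f) -> (forall x y, f x = f y -> H (x^-1 * y)) ->
  finite_index H.
Proof.
move=> sgH finf fH.
pose F v := lcoset H (xget 1 [set x | f x = v]).
apply: (sub_finite_set _ (finite_image F finf)).
move=> _ [x _ <-]; exists (f x); first by exists x.
apply/(lcoset_eq _ _ _ sgH)/fH.
by case: xgetP => [y _ //|/(_ x)[]].
Qed.

Lemma finite_index_setI H K : is_subgroup H -> is_subgroup K ->
  finite_index H -> finite_index K -> finite_index (H `&` K).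
Proof.
move=> sgH sgK fH fK.
apply: (finite_index_separated _ (fun x => (lcoset H x, lcoset K x))).
- exact: setI_is_subgroup.
- apply: (sub_finite_set _ (finite_setX fH fK)) => _ [x _ <-].
  by split; exists x.
- by move=> x y [/(lcoset_eq _ _ _ sgH) ? /(lcoset_eq _ _ _ sgK) ?].
Qed.

(** The cosets of the centralizer of t correspond to the conjugates of t, and a
    finite intersection of subgroups of finite index has finite index. *)
Lemma finite_index_cent L : finite_set L ->
  (forall t, L t -> finite_set (range (conjg t))) ->
  finite_index [set g | forall t, L t -> commute t g].
Proof.
move=> /finite_seqP[s ->]; elim: s => [|t s IH] finc.
  have -> : [set g | forall t : G, [set` [::]] t -> commute t g] = setT.
    by apply/seteqP; split.
  apply: (finite_index_separated _ (fun=> tt)) => //.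
  exact/is_subgroupP.
have -> : [set g | forall t0 : G, [set` t :: s] t0 -> commute t0 g] =
    [set g | forall t0, [set t] t0 -> commute t0 g] `&`
    [set g | forall t0 : G, [set` s] t0 -> commute t0 g].
  apply/seteqP; split=> [g cg|g [cg cs] z].
    split=> [_ ->|z zs]; apply: cg; rewrite /= inE ?eqxx //.
    by rewrite (zs : z \in s) orbT.
  by rewrite /= inE => /predU1P[->|/cs//]; apply: cg.
apply: finite_index_setI; [exact: cent_is_subgroup|exact: cent_is_subgroup| |].
  apply: (finite_index_separated _ (fun g => t ^ g^-1)).
  - exact: cent_is_subgroup.
  - apply: (@sub_finite_set _ _ (range (conjg t))).
      by move=> _ [g _ <-]; exists g^-1.
    by apply: finc; rewrite /= inE eqxx.
  - move=> x y e _ ->; rewrite /commute [LHS]conjgC.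
    by rewrite conjgM e conjgKV.
by apply: IH => z zs; apply: finc; rewrite /= inE (zs : z \in s) orbT.
Qed.

Definition coset_rep H x := xget 1 (lcoset H x).

Lemma coset_repP H x : is_subgroup H -> H (x^-1 * coset_rep H x).
Proof.
move=> /is_subgroupP[H1 _ _]; rewrite /coset_rep.
case: xgetP => [_ _ [h Hh <-]|/(_ x) []]; first by rewrite mulKg.
by exists 1; rewrite ?mulg1.
Qed.

Lemma coset_repVP H x : is_subgroup H -> H ((coset_rep H x)^-1 * x).
Proof.
move=> sgH; have /is_subgroupP[_ _ HV] := sgH.
by have := HV _ (coset_repP H x sgH); rewrite invgM invgK.
Qed.

Lemma coset_rep_eq H x y : is_subgroup H ->
  coset_rep H x = coset_rep H y <-> H (x^-1 * y).
Proof.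
move=> sgH; split=> [e|/(lcoset_eq _ _ _ sgH) e]; last by rewrite /coset_rep e.
have /is_subgroupP[_ HM HV] := sgH.
have := HM _ _ (coset_repP H x sgH) (HV _ (coset_repP H y sgH)).
by rewrite e invgM invgK !mulgA mulgK.
Qed.

Lemma coset_rep_id H x : is_subgroup H ->
  coset_rep H (coset_rep H x) = coset_rep H x.
Proof. by move=> sgH; apply/esym/(coset_rep_eq _ _ _ sgH); apply: coset_repP. Qed.

Lemma coset_repM H g x : is_subgroup H ->
  coset_rep H (g * coset_rep H x) = coset_rep H (g * x).
Proof.
move=> sgH; apply/esym/(coset_rep_eq _ _ _ sgH).
by rewrite invgM mulgA mulgVK; apply: coset_repP.
Qed.

Lemma finite_coset_rep H : finite_index H -> finite_set (range (coset_rep H)).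
Proof.
move=> fH; apply: (sub_finite_set _ (finite_image (xget 1) fH)) => _ [x _ <-].
by exists (lcoset H x) => //; exists x.
Qed.

(** Schreier's lemma.  With c the choice of representatives, H is generated by
    the elements c(st)^-1 st, for s in S and t a representative, together with
    c(1)^-1, which is needed because c(1) need not be 1.  Indeed the property
    that c(x)^-1 x is generated by them is preserved, in both directions, when x
    is multiplied on the left by an element of S. *)
Lemma schreier S H : finite_set S -> generates S -> is_subgroup H ->
  finite_index H -> exists2 L, finite_set L & generated L = H.
Proof.
move=> fS gS sgH fH; pose c := coset_rep H.
have /is_subgroupP[H1 HM HV] := sgH.
pose L : set G :=
  (c 1)^-1 |` [set (c (s * t))^-1 * (s * t) | s in S & t in range c].
have fL : finite_set L.
  rewrite finite_setU; split; first exact: finite_set1.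
  exact: finite_image2 fS (finite_coset_rep H fH).
exists L => //.
have /is_subgroupP[K1 KM KV] := generated_is_subgroup L.
have cM s x : c (s * c x) = c (s * x) by apply: coset_repM.
have cV x : H ((c x)^-1 * x) by apply: coset_repVP.
apply/seteqP; split.
  apply: generated_min => // _ [->|[s Ss [t ct <-]]] //.
  by have := cV 1; rewrite mulg1.
pose P x := generated L ((c x)^-1 * x).
have PM s x : S s -> P x -> P (s * x).
  move=> Ss Px; rewrite /P -cM.
  have -> : (c (s * c x))^-1 * (s * x) =
      ((c (s * c x))^-1 * (s * c x)) * ((c x)^-1 * x).
    by rewrite !mulgA mulgK.
  apply: KM => //; apply: subset_generated; right.
  by exists s => //; exists (c x) => //; exists x.
have PV s x : S s -> P (s * x) -> P x.
  move=> Ss Psx; rewrite /P.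
  have -> : (c x)^-1 * x =
      ((c (s * c x))^-1 * (s * c x))^-1 * ((c (s * x))^-1 * (s * x)).
    by rewrite cM !invgM invgK !mulgA mulgK mulgVK.
  apply: KM => //; apply: KV; apply: subset_generated; right.
  by exists s => //; exists (c x) => //; exists x.
have allP x : P x.
  (* As an equivalence for all y, the property of x is closed under inverses,
     so that membership of S is enough. *)
  have : forall y, P y <-> P (x * y).
    apply: (generates_ind S [set x | forall y, P y <-> P (x * y)]) => //.
      apply/is_subgroupP; split=> /= [y|y z Py Pz t|y Py z]; first by rewrite mul1g.
        by rewrite -mulgA; apply: iff_trans (Py _).
      by have := Py (y^-1 * z); rewrite mulVKg => -[? ?]; split.
    by move=> s Ss y; split; [apply: PM|apply: PV].
  move=> /(_ 1); rewrite mulg1 => -[Px _]; apply: Px.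
  by rewrite /P mulg1; apply: subset_generated; left.
move=> h Hh; have c1 : generated L (c 1).
  by rewrite -[c 1]invgK; apply: KV; apply: subset_generated; left.
have := KM _ _ c1 (allP h).
have -> : c 1 = c h by apply/coset_rep_eq; rewrite // invg1 mul1g.
by rewrite mulVKg.
Qed.

Lemma finite_index_finite H : is_subgroup H -> finite_index H -> finite_set H ->
  finite_set [set: G].
Proof.
move=> sgH fH fin.
have fT := finite_coset_rep H fH.
apply: (sub_finite_set _ (finite_image2 (fun t h => t * h) fT fin)) => x _.
exists (coset_rep H x); first by exists x.
exists ((coset_rep H x)^-1 * x); last by rewrite mulVKg.
exact: coset_repVP.
Qed.

(** * Torsion elements *)

Definition torsion x := exists2 n, (0 < n)%N & x ^+ n = 1.

Lemma torsion_root x n : (0 < n)%N -> torsion (x ^+ n) -> torsion x.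
Proof.
by move=> n0 [m m0 xm]; exists (n * m)%N; rewrite ?muln_gt0 ?n0 // expgnA.
Qed.

Lemma torsionX x n : torsion x -> torsion (x ^+ n).
Proof.
by move=> [m m0 xm]; exists m => //; rewrite -expgnA mulnC expgnA xm expg1n.
Qed.

Lemma torsionM x y : commute x y -> torsion x -> torsion y -> torsion (x * y).
Proof.
move=> cxy [m m0 xm] [n n0 yn]; exists (m * n)%N; first by rewrite muln_gt0 m0.
by rewrite expgMn // expgnA xm expg1n mul1g mulnC expgnA yn expg1n.
Qed.

Lemma torsionV x : torsion x -> torsion x^-1.
Proof. by move=> [n n0 xn]; exists n => //; rewrite expVgn xn invg1. Qed.

(** The exponent of v comes from (r + e)^2 - r^2 = (r + (r + e)) e. *)
Lemma quadratic_difference y v r e : commute y v ->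
  y ^+ r * v ^+ (1 + r * r) =
    y ^+ (r + e) * v ^+ (1 + (r + e) * (r + e)) ->
  (y * v ^+ (r + (r + e))) ^+ e = 1.
Proof.
move=> cyv E.
have -> : (y * v ^+ (r + (r + e))) ^+ e = y ^+ e * v ^+ ((r + (r + e)) * e).
  by rewrite expgMn ?expgnA //; apply: commuteX.
apply: (mulgI (y ^+ r)); rewrite mulgA -expgnDr.
apply: (mulIg (v ^+ (1 + r * r))); rewrite mulg1 E -mulgA -expgnDr.
congr (_ * v ^+ _).
by rewrite !mulnDl !mulnDr (mulnC e r) !addnA; lia.
Qed.

(** The differences between consecutive values of r say that y v^(r1 + r2) and
    y v^(r2 + r3) are torsion; their quotient is a nontrivial power of v. *)
Lemma torsion_quadratic a y v r1 r2 r3 : commute y v -> (r1 < r2 < r3)%N ->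
  (forall r, r \in [:: r1; r2; r3] -> a = y ^+ r * v ^+ (1 + r * r)) ->
  torsion a.
Proof.
move=> cyv /andP[r12 r23] ar.
have d12 : (y * v ^+ (r1 + r2)) ^+ (r2 - r1) = 1.
  have := quadratic_difference y v r1 (r2 - r1) cyv.
  by rewrite subnKC ?(ltnW r12) //; apply; rewrite -!ar ?inE ?eqxx ?orbT.
have d23 : (y * v ^+ (r2 + r3)) ^+ (r3 - r2) = 1.
  have := quadratic_difference y v r2 (r3 - r2) cyv.
  by rewrite subnKC ?(ltnW r23) //; apply; rewrite -!ar ?inE ?eqxx ?orbT.
have t12 : torsion (y * v ^+ (r1 + r2)) by exists (r2 - r1)%N; rewrite ?subn_gt0.
have t23 : torsion (y * v ^+ (r2 + r3)) by exists (r3 - r2)%N; rewrite ?subn_gt0.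
have cX m n : commute (y * v ^+ m) (v ^+ n).
  apply/commute_sym/commuteM; first exact/commute_sym/commuteX.
  exact: commuteX2.
have tv : torsion v.
  apply: (@torsion_root _ (r3 - r1)%N); first by rewrite subn_gt0 (ltn_trans r12).
  have -> : v ^+ (r3 - r1) = (y * v ^+ (r1 + r2))^-1 * (y * v ^+ (r2 + r3)).
    have -> : (r2 + r3)%N = (r1 + r2 + (r3 - r1))%N by lia.
    by rewrite (expgnDr _ (r1 + r2)) (mulgA y) mulKg.
  apply: torsionM => //; last exact: torsionV.
  apply/commute_sym/commuteV/commuteM; last exact: cX.
  by apply/commute_sym/commuteM => //; apply: commuteX.
have ty : torsion y.
  rewrite -[y](mulgK (v ^+ (r1 + r2))); apply: torsionM => //.
    by apply: commuteV; apply: cX.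
  exact/torsionV/torsionX.
rewrite (ar r1) ?mem_head //.
by apply: torsionM; [exact: commuteX2|exact: torsionX|exact: torsionX].
Qed.

(** Some fibre of f is infinite, hence unbounded in nat. *)
Lemma pigeonhole3 (X : Type) (F : set X) (f : nat -> X) : finite_set F ->
  (forall k, F (f k)) ->
  exists i j k, [/\ (i < j < k)%N, f j = f i & f k = f i].
Proof.
move=> finF Ff.
have [v infv] : exists v, infinite_set [set k | f k = v].
  apply: contrapT => /forallNP fin; apply: infinite_nat.
  have -> : [set: nat] = \bigcup_(v in F) [set k | f k = v].
    by apply/seteqP; split=> // k _; exists (f k).
  by apply: bigcup_finite => // v _; apply: contrapT => /fin.
have next N : exists2 k, (N < k)%N & f k = v.
  apply: contrapT => no; apply: infv.
  apply: (sub_finite_set _ (finite_II N.+1)) => k /= fk.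
  by rewrite ltnNge; apply/negP => Nk; apply: no; exists k.
have [i _ fi] := next 0; have [j ij fj] := next i; have [k jk fk] := next j.
by exists i, j, k; rewrite ij jk fi fj fk.
Qed.

(** By induction on the generators: if K is the finite group generated by the
    previous ones and t has order n, the products t^i k with i < n and k in K are
    finitely many and form a group. *)
Lemma generated_torsion_finite L : finite_set L ->
  (forall x y, L x -> L y -> commute x y) -> (forall x, L x -> torsion x) ->
  finite_set (generated L).
Proof.
move=> /finite_seqP[s ->]; elim: s => [|t s IH] cs ts.
  apply: (sub_finite_set _ (finite_set1 1)); apply: generated_min => //.
  apply/is_subgroupP; split=> //= [x y -> ->|x ->]; rewrite ?mulg1 ?invg1 //.
have {}IH : finite_set (generated [set` s]).
  apply: IH => [x y xs ys|x xs].
    by apply: cs; rewrite /= inE; apply/orP; right.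
  by apply: ts; rewrite /= inE; apply/orP; right.
have ct x : generated [set` s] x -> commute t x.
  pose Ct := [set x | forall z, [set t] z -> commute z x].
  move=> gx; apply: (generated_min [set` s] Ct _ _ _ gx) => //.
    exact: cent_is_subgroup.
  by move=> z zs _ ->; apply: cs; rewrite /= inE ?eqxx //; apply/orP; right.
have [n n0 tn] : torsion t by apply: ts; rewrite /= mem_head.
have /is_subgroupP[K1 KM KV] := generated_is_subgroup [set` s].
set K := generated [set` s] in K1 KM KV ct IH.
have ctX j x : K x -> commute x (t ^+ j).
  by move=> Kx; apply/commuteX/commute_sym/ct.
pose Q : set G := [set x | exists i, exists2 k, K k & x = t ^+ i * k].
suff QK : generated [set` t :: s] `<=` Q.
  apply: (sub_finite_set _
    (finite_image2 (fun i k => t ^+ i * k) (finite_II n) IH)) => z.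
  move=> /QK[i [k Kk ->]].
  exists (i %% n)%N; first by rewrite /= ltn_mod.
  exists k => //; rewrite {2}(divn_eq i n) expgnDr mulnC expgnA tn.
  by rewrite expg1n mul1g.
apply: generated_min.
  apply/is_subgroupP; split.
  - by exists 0, 1; rewrite ?mulg1.
  - move=> _ _ [i [k Kk ->]] [j [l Kl ->]]; exists (i + j)%N, (k * l).
      exact: KM.
    by rewrite expgnDr -!mulgA; congr (_ * _); rewrite !mulgA ctX.
  - move=> _ [i [k Kk ->]]; exists (i * n.-1)%N, k^-1; first exact: KV.
    rewrite invgM; have -> : (t ^+ i)^-1 = t ^+ (i * n.-1).
      apply: mulg1_eq; rewrite -expgnDr -mulnS prednK // mulnC expgnA tn.
      exact: expg1n.
    by apply: ctX; apply: KV.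
move=> x; rewrite /= inE => /predU1P[->|xs]; first by exists 1%N, 1; rewrite ?mulg1.
by exists 0, x; rewrite ?mul1g //; apply: subset_generated.
Qed.

(** * Dilations along an abelian normal subgroup of finite index *)

Lemma perm_prodg_commute (I : eqType) (r1 r2 : seq I) (F : I -> G) :
  (forall i j, commute (F i) (F j)) -> perm_eq r1 r2 ->
  \prod_(i <- r1) F i = \prod_(i <- r2) F i.
Proof.
move=> cF; elim: r1 r2 => [|x s IH] r2 e.
  by rewrite perm_sym in e; rewrite (perm_nilP e).
have xr2 : x \in r2 by rewrite -(perm_mem e) mem_head.
move: e; case/path.splitPr: xr2 => p q e.
have e' : perm_eq s (p ++ q).
  by rewrite -(perm_cons x); apply: (perm_trans e); rewrite -cat1s perm_catCA.
rewrite big_cons (IH _ e') !big_cat big_cons /= !mulgA; congr (_ * _).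
exact: commute_prod.
Qed.

Section AbelianNormal.
Variable A : set G.
Hypotheses (sgA : is_subgroup A) (fA : finite_index A).
Hypothesis cA : forall x y, A x -> A y -> commute x y.
Hypothesis nA : forall x g, A x -> A (x ^ g).

(** With representatives c(t) and d the index of A, u(g) is the product over the
    cosets t of the elements g t c(gt)^-1 of A.  The crossed homomorphism identity
    holds factor by factor after reindexing the product for g along the
    permutation t |-> c(ht) of the representatives.  An element a of A fixes
    every coset by normality, so each factor of u(a) is a. *)
Lemma transfer_crossed_hom : exists d, exists u : G -> G,
  [/\ (0 < d)%N, forall g, A (u g),
      forall g h, u (g * h) = u g * u h ^ g^-1 &
      forall a, A a -> u a = a ^+ d].
Proof.
have /is_subgroupP[A1 AM AV] := sgA.
have [s es] := (finite_seqP _).1 (finite_coset_rep A fA).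
pose c := coset_rep A; pose T := undup s.
have memT x : c x \in T.
  by rewrite mem_undup; have : range c (c x) by []; rewrite es.
have Tc t : t \in T -> c t = t.
  rewrite mem_undup => ts; have : [set` s] t by [].
  by rewrite -es => -[x _ <-]; apply: coset_rep_id.
have cM g x : c (g * c x) = c (g * x) by apply: coset_repM.
have permT h : perm_eq [seq c (h * t) | t <- T] T.
  have injT : {in T &, injective (fun t => c (h * t))}.
    move=> t t' tT t'T /(coset_rep_eq _ _ _ sgA).
    by rewrite invgM mulgA mulgVK => /(coset_rep_eq _ _ _ sgA); rewrite -/c !Tc.
  have uT : uniq [seq c (h * t) | t <- T] by rewrite map_inj_in_uniq ?undup_uniq.
  apply: uniq_perm; rewrite ?undup_uniq //.
  apply: (uniq_min_size uT _ _).2; last by rewrite size_map.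
  by move=> _ /mapP[t _ ->].
pose F g t := g * t * (c (g * t))^-1.
have AF g t : A (F g t).
  have := nA _ (g * t)^-1 (coset_repVP A (g * t) sgA).
  by rewrite conjgE invgK -/c mulgK.
exists (size T), (fun g => \prod_(t <- T) F g t); split.
- by have := memT 1; case: (T).
- by move=> g; elim/big_ind: _.
- move=> g h; rewrite -(perm_prodg_commute _ _ _ (F g) _ (permT h)); last first.
    by move=> i j; apply: cA.
  rewrite big_map conjg_prod -prodgM_commute; last first.
    by move=> i j _ _; apply: cA => //; apply: nA.
  apply: eq_bigr => t _; rewrite [RHS]cA //; last exact: nA.
  by rewrite /F conjgE invgK cM !mulgA !mulgVK.
- move=> a Aa; rewrite (eq_big_seq (fun=> a)).
    by rewrite big_const_seq count_predT -Monoid.iteropE.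
  move=> t tT; rewrite /F; suff -> : c (a * t) = t by rewrite mulgK.
  rewrite -[RHS]Tc //; apply/esym/(coset_rep_eq _ _ _ sgA).
  by rewrite -conjgE; apply: nA.
Qed.

(** Twisting the identity by the m-th power of the crossed homomorphism. *)
Lemma dilation : exists2 d, (0 < d)%N & forall m, exists E : G -> G,
  [/\ {morph E : x y / x * y}, forall g, A (E g * g^-1) &
      forall a, A a -> E a = a ^+ (1 + d * m)].
Proof.
have /is_subgroupP[A1 AM AV] := sgA.
have [d [u [d0 Au uM ua]]] := transfer_crossed_hom.
exists d => // m; exists (fun g => u g ^+ m * g); split.
- move=> g h; rewrite uM expgMn; last by apply: cA => //; apply: nA.
  by rewrite -conjXg -!mulgA; congr (_ * _); rewrite invgK !mulgA mulgVK.
- by move=> g; rewrite mulgK; apply: is_subgroupX.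
- by move=> a Aa; rewrite ua // -expgnA add1n expgSr.
Qed.

Section Dilated.
Variables (S L : set G) (r : nat) (E : G -> G).
Hypotheses (gS : generates S) (gL : generated L = A).
Hypothesis EM : {morph E : x y / x * y}.
Hypothesis EA : forall g, A (E g * g^-1).
Hypothesis Ea : forall a, A a -> E a = a ^+ (1 + r * r).

(** The exponent r is prime to 1 + r^2, so that these elements still generate
    every element of L. *)
Definition dilated_gens : set G := E @` S `|` [set a ^+ r | a in L].

Let E1 : E 1 = 1.
Proof. by apply: (mulgI (E 1)); rewrite -EM !mulg1. Qed.

Let EV x : E x^-1 = (E x)^-1.
Proof. by apply/esym/mulg1_eq; rewrite -EM mulgV. Qed.

Let LA : L `<=` A.
Proof. by rewrite -gL; apply: subset_generated. Qed.

Lemma dilated_gens_generates : generates dilated_gens.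
Proof.
have /is_subgroupP[K1 KM KV] := generated_is_subgroup dilated_gens.
set K := generated _ in K1 KM KV.
have KE x : K (E x).
  apply: (generates_ind S [set x | K (E x)]) => //.
    apply/is_subgroupP; split=> /= [|y z Ky Kz|y Ky]; rewrite ?E1 ?EM ?EV //.
      exact: KM.
    exact: KV.
  by move=> s Ss; apply: subset_generated; left; exists s.
have KA : A `<=` K.
  rewrite -gL; apply: generated_min; first exact: generated_is_subgroup.
  move=> a La.
  have Kr : K (a ^+ r) by apply: subset_generated; right; exists a.
  (* a is recovered as a^(1 + r^2) divided by the r-th power of a^r. *)
  have := KM _ _ (KE a) (KV _ (is_subgroupX _ _ r (generated_is_subgroup _) Kr)).
  by rewrite Ea ?expgnDr -?expgnA ?mulgK ?expg1 //; apply: LA.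
apply/seteqP; split=> // x _.
have := KM _ _ (KV _ (KA _ (EA x))) (KE x).
by rewrite invgM invgK mulgVK.
Qed.

(** Move the letters b^r to the left of the letters E(s): conjugating y^r by E(s)
    gives the r-th power of a conjugate of y, and, A being abelian, E(s) conjugates
    y just as s does.  So y is a word in S and L that does not involve m or r.
    Each conjugation adds two letters to y; radius 3n leaves room for y and v. *)
Lemma dilated_word n x : product_of_length dilated_gens n x ->
  exists y v, [/\ A y, ball (S `|` L) (n * 3) y, ball (S `|` L) (n * 3) v &
                  x = y ^+ r * E v].
Proof.
have /is_subgroupP[A1 AM AV] := sgA.
have conjA z c : A z -> A c -> z ^ c = z.
  by move=> Az Ac; rewrite conjgE (cA z c) ?mulKg.
have symU s : sym_gens S s -> ball (S `|` L) 1 s.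
  move=> Ss; apply: ball_sym; case: Ss => [?|[t ? <-]]; first by left; left.
  by right; exists t => //; left.
have symL s : sym_gens L s -> ball (S `|` L) 1 s.
  move=> Ss; apply: ball_sym; case: Ss => [?|[t ? <-]]; first by left; right.
  by right; exists t => //; right.
elim: n x => [|n IH] x.
  move=> /product_of_length0->; exists 1, 1; split=> //; try exact: ball1.
  by rewrite E1 mulg1 expg1n.
move=> /product_of_lengthS[s [x' [Ss /IH[y [v [Ay yb vb ->]]] ->]]].
have : (exists2 t, sym_gens S t & s = E t) \/
       (exists2 a, sym_gens L a & s = a ^+ r).
  case: Ss => [[[t St <-]|[a La <-]]|[_ [[t St <-]|[a La <-]] <-]].
  - by left; exists t => //; left.
  - by right; exists a => //; left.
  - by left; exists t^-1; [right; exists t|rewrite EV].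
  - by right; exists a^-1; [right; exists a|rewrite expVgn].
rewrite mulSn => -[[t St ->]|[a La ->]].
  exists (y ^ t^-1), (t * v); split.
  - exact: nA.
  - rewrite conjgE invgK; apply: (@ballW _ (1 + (n * 3 + 1))%N).
      by rewrite addnCA addnC.
    apply: ballM; first exact: symU.
    by apply: ballM => //; apply: symU; apply: sym_gensV.
  - apply: (@ballW _ (1 + n * 3)%N); first by rewrite leq_add2r.
    by apply: ballM => //; apply: symU.
  - rewrite EM !mulgA; congr (_ * _).
    (* E t and t differ by an element of A, which centralizes A. *)
    have -> : y ^ t^-1 = y ^ (E t)^-1.
      rewrite -[E t in RHS](mulgVK t) invgM [RHS]conjgM [RHS]conjA //.
        exact: nA.
      exact: AV.
    by rewrite -conjXg -conjgCV.
have Aa : A a by case: La => [/LA//|[b /LA Ab <-]]; apply: AV.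
exists (a * y), v; split.
- exact: AM.
- apply: (@ballW _ (1 + n * 3)%N); first by rewrite leq_add2r.
  by apply: ballM => //; apply: symL.
- by apply: ballW vb; rewrite leq_addl.
- by rewrite expgMn ?mulgA //; apply: cA.
Qed.

(** As E is the identity modulo A, the factor E(v) of an element of A forces v to
    lie in A, where E is a power map. *)
Lemma dilated_ball n a : A a -> ball dilated_gens n a ->
  exists y v, [/\ A y, A v, ball (S `|` L) (n * 3) y,
                  ball (S `|` L) (n * 3) v & a = y ^+ r * v ^+ (1 + r * r)].
Proof.
have /is_subgroupP[A1 AM AV] := sgA.
move=> Aa [m mn /dilated_word[y [v [Ay yb vb av]]]]; exists y, v.
have AEv : A (E v).
  have -> : E v = (y ^+ r)^-1 * a by rewrite av mulKg.
  apply: AM => //; apply: AV.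
  exact: is_subgroupX.
have Av : A v.
  by have := AM _ _ (AV _ (EA v)) AEv; rewrite invgM invgK mulgVK.
have le3 : (m * 3 <= n * 3)%N by rewrite leq_mul2r.
by split=> //; [apply: ballW yb|apply: ballW vb|rewrite av Ea].
Qed.

End Dilated.

(** Infinitely many dilated generating sets share the same finite set of possible
    pairs (y, v). *)
Lemma G_bound_torsion S L a : finite_set S -> generates S -> finite_set L ->
  generated L = A -> A a -> @G_bound G a -> torsion a.
Proof.
move=> fS gS fL gL Aa /G_boundP[n ba].
have [d d0 dil] := dilation.
have fB : finite_set (ball (S `|` L) (n * 3)).
  by apply: ball_finite; rewrite finite_setU.
have sol k : exists p : G * G, [/\ A p.1, A p.2, ball (S `|` L) (n * 3) p.1,
    ball (S `|` L) (n * 3) p.2 &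
    a = p.1 ^+ (d * k) * p.2 ^+ (1 + (d * k) * (d * k))].
  (* The exponent m = d k^2 makes 1 + d m equal to 1 + r^2 for r = d k. *)
  have [E [EM EA Ea]] := dil (d * k * k)%N.
  have {}Ea b : A b -> E b = b ^+ (1 + d * k * (d * k)).
    by move=> Ab; rewrite Ea // mulnA mulnAC !mulnA.
  have gE : generates (dilated_gens S L (d * k) E).
    exact: dilated_gens_generates.
  have fE : finite_set (dilated_gens S L (d * k) E).
    by rewrite finite_setU; split; apply: finite_image.
  have [y [v [Ay Av yb vb av]]] :=
    dilated_ball S L (d * k) E gL EM EA Ea n a Aa (ba _ gE fE).
  by exists (y, v).
have [f fP] := choice sol.
have [k|i [j [k [ijk fj fk]]]] := pigeonhole3 _ _ f (finite_setX fB fB).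
  by have [_ _ ? ? _] := fP k.
have [Ay Av _ _ ai] := fP i.
apply: (torsion_quadratic a (f i).1 (f i).2 (d * i) (d * j) (d * k)).
- exact: cA.
- by rewrite !ltn_pmul2l.
- move=> r; rewrite !inE => /or3P[] /eqP-> //.
    by have [_ _ _ _] := fP j; rewrite fj.
  by have [_ _ _ _] := fP k; rewrite fk.
Qed.

End AbelianNormal.

(** * The main theorem *)

(** Apply the above to the centre A of B: it is finitely generated, abelian and
    consists of bounded elements. *)
Lemma finite_of_finite_index_G_bound : finitely_generated G ->
  finite_index (@G_bound G) -> finite_set [set: G].
Proof.
move=> fgG fB; have [S fS gS] := fgG.
have sgB := G_bound_is_subgroup.
set B := @G_bound G in fB sgB.
have [M fM gM] := schreier S B fS gS sgB fB.
have MB : M `<=` B by rewrite -gM; apply: subset_generated.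
pose C := [set g | forall t, M t -> commute t g].
have sgC : is_subgroup C by apply: cent_is_subgroup.
have fC : finite_index C.
  by apply: finite_index_cent => // t /MB; apply: G_bound_finite_class.
have CB x y : C x -> B y -> commute x y.
  pose Cent := [set y | forall t, [set x] t -> commute t y].
  move=> Cx; rewrite -gM => My; apply: (generated_min M Cent _ _ _ My) => //.
    exact: cent_is_subgroup.
  by move=> t Mt _ ->; apply/commute_sym/Cx.
pose A := B `&` C.
have fA : finite_index A by apply: finite_index_setI.
have sgA : is_subgroup A by apply: setI_is_subgroup.
have cA x y : A x -> A y -> commute x y by move=> [_ Cx] [By _]; apply: CB.
have nA x g : A x -> A (x ^ g).
  move=> [Bx Cx]; split; first exact: G_bound_conjg.
  move=> t Mt; have := CB _ _ Cx (G_bound_conjg _ g^-1 (MB _ Mt)).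
  by move=> e; rewrite /commute -[t](conjgKV g) -!conjMg e.
have [L fL gL] := schreier S A fS gS sgA fA.
have LA : L `<=` A by rewrite -gL; apply: subset_generated.
apply: (finite_index_finite A) => //; rewrite -gL.
apply: generated_torsion_finite => // [x y /LA Ax /LA Ay|x /LA Ax].
  exact: cA.
by apply: (G_bound_torsion A sgA fA cA nA S L) => //; case: Ax.
Qed.

End Groups.

Theorem corollary4p3 (G : groupType) (fgG : finitely_generated G) :
  infinite_index (@G_bound G) \/
  (finite_set [set: G] /\ [set: G] = @G_bound G).
Proof.
have [fB|] := pselect (finite_index G (@G_bound G)); last by left.
right; have finG := finite_of_finite_index_G_bound G fgG fB.
by split=> //; apply: G_bound_finite.
Qed.
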